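(* Every automorphism $\alpha$ of a finite group $G$ such that $l:=\mathrm{ord}(\alpha)>\frac{1}{2}|G|$ has a cycle of length $l$.
   Context: $\mathrm{ord}(\alpha)$ is the order of $\alpha$ in $\mathrm{Aut}(G)$. Cycles of $\alpha$ are the cycles of $\alpha$ viewed as a permutation of the underlying set of $G$. *)

(* Defs.v *)
From mathcomp Require Import all_boot all_fingroup.

Set Implicit Arguments.
Unset Strict Implicit.
Unset Printing Implicit Defensive.

(* Main.v *)
Require Import Defs.
From mathcomp Require Import all_boot all_fingroup all_solvable.

Set Implicit Arguments.
Unset Strict Implicit.
Unset Printing Implicit Defensive.

Local Open Scope group_scope.

(** In the semidirect product of [G] by [A = <alpha>], a regular cycle is an
  orbit of [x] in [G] under conjugation by [A] with ['C_A[x]] acting trivially.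
  If ['F(G) = 1], Zenkov's theorem puts a minimal [A :&: A ^ g] inside the
  Fitting subgroup of the product, which centralises [G], so the orbit of [g] is
  regular. Otherwise let [E] be a minimal normal elementary abelian
  [p]-subgroup inside [G] and [D] the kernel of the action of [A] on [G / E]. In
  both cases below, [D] acts on [G] as a group of order at most [#|E|], so that
  the hypothesis on the order passes to [G / E], and a regular orbit of [G / E]
  has to be lifted.
  - If [D] centralises [E], then [D] acts as a group of order 1 or [p], and it is
    enough to lift a point lying outside the invariant subgroup ['C_G(D)]. If
    that subgroup is proper, it is too small to contain the preimage of a regular
    orbit; if it is all of [G], the order of [A] on [G] is already too small.
  - Otherwise some [d] in [D] acts without fixed points on [E], whence
    [G = E * 'C_G[d]]; lift the point into ['C_G[d]] and multiply it by a
    nontrivial element of [E]. *)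

(* Zenkov's theorem. *)
Lemma minimal_cap_Fitting (gT : finGroupType) (G A B : {group gT}) :
    A \subset G -> B \subset G -> abelian A -> abelian B ->
    {in G, forall g, A :&: B :^ g \subset A :&: B -> A :&: B \subset B :^ g} ->
  A :&: B \subset 'F(G).
Proof.
have [n] := ubnP #|G|; elim: n G A B => // n IHn G A B /ltnSE-leGn.
move=> sAG sBG cAA cBB minAB.
(* If [A] and some [B :^ g] generate [G], their intersection is central, hence invariant under
   conjugation and inside [A :&: B]; minimality then puts [A :&: B] in ['Z(G)]. *)
have [/exists_inP[g Gg /eqP defG] | ltG] :=
    boolP [exists g in G, A <*> B :^ g == G :> {set gT}].
  have sZ : A :&: B :^ g \subset 'Z(G).
    rewrite subsetI subIset ?sAG //= -defG centY subsetI.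
    rewrite (subset_trans (subsetIl _ _)) //=.
    by rewrite (subset_trans (subsetIr _ _)) // -abelianE abelianJ.
  apply: subset_trans (Fitting_max (center_normal G) _); last first.
    exact: abelian_nil (center_abelian G).
  apply: (subset_trans _ sZ); rewrite subsetI subsetIl minAB //.
  rewrite subsetI subsetIl /=; apply/subsetP=> z ABz.
  have /setIP[_ /centP cz] := subsetP sZ z ABz.
  have /setIP[_] := ABz; rewrite mem_conjg conjgE invgK mulgA -(cz g Gg).
  by rewrite mulgK.
rewrite -(Sylow_gen [group of A :&: B]) gen_subG.
apply/bigcupsP=> P /SylowP[p _ sylP].
apply: subset_trans (Fitting_max (pcore_normal p G) _); last first.
  exact: pgroup_nil (pcore_pgroup p G).
apply/subsetP=> x Px; have sPAB := pHall_sub sylP.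
have /setIP[Ax Bx] := subsetP sPAB x Px.
(* It is enough that [x] and [x ^ g] generate a [p]-group. Induction in the proper subgroup [J] puts
   [x] in ['O_p(J)], which [x ^ g] normalises. *)
apply: Baer_Suzuki => [|g Gg]; first exact: subsetP sAG x Ax.
pose J := [group of A <*> B :^ g].
have sJG : J \subset G by rewrite join_subG sAG conj_subG.
have sAJ : A \subset J by apply: joing_subl.
have sBgJ : B :^ g \subset J by apply: joing_subr.
have ltJ : #|J| < n.
  apply: leq_trans leGn; apply: proper_card; rewrite properEneq sJG andbT.
  by apply: contra ltG => eqJ; apply/exists_inP; exists g.
have sAF : A :&: [group of B :&: J] \subset 'F(J).
  apply: IHn; rewrite ?subsetIr //; first exact: abelianS (subsetIl _ _) cBB.
  move=> h Jh /=; rewrite conjIg (conjGid Jh) => sAA.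
  rewrite subsetI setIA subsetIr andbT -setIA [B :&: J]setIC setIA.
  rewrite (setIidPl sAJ); apply: minAB (subsetP sJG h Jh) _.
  apply/subsetP=> z /setIP[Az Bz]; have := subsetP sAA z.
  by rewrite !inE Az Bz (subsetP sAJ) //= => /(_ isT)/andP[->].
have JPx : x \in 'O_p(J).
  rewrite -p_core_Fitting (mem_normal_Hall (nilpotent_pcore_Hall p (Fitting_nil J))).
  - exact: mem_p_elt (pHall_pgroup sylP) Px.
  - exact: pcore_normal.
  - by apply: subsetP sAF _ _; rewrite !inE Ax Bx (subsetP sAJ).
have nxg : <[x ^ g]> \subset 'N('O_p(J)).
  rewrite cycle_subG (subsetP (normal_norm (pcore_normal p J))) //.
  by rewrite (subsetP sBgJ) // memJ_conjg.
apply: (@pgroupS _ _ ('O_p(J) <*> <[x ^ g]>)%G).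
  rewrite gen_subG; apply/subsetP=> y /set2P[] ->.
    exact: subsetP (joing_subl _ _) _ JPx.
  exact: subsetP (joing_subr _ _) _ (cycle_id _).
rewrite /= norm_joinEr // pgroupM pcore_pgroup /= cycleJ pgroupJ.
exact: mem_p_elt (pHall_pgroup sylP) Px.
Qed.

(** * Regular orbits when the Fitting subgroup is trivial *)

Lemma Fitting1_regular_orbit (gT : finGroupType) (G A : {group gT}) :
    abelian A -> A \subset 'N(G) -> 'F(G) = 1 ->
  exists2 x, x \in G & 'C_A[x] \subset 'C(G).
Proof.
move=> cAA nGA FG1; pose H := [group of G <*> A].
have defH : G <*> A = A * G by rewrite norm_joinEr // -normC.
have [sGH sAH] : G \subset H /\ A \subset H.
  by split; [apply: joing_subl | apply: joing_subr].
have nsGH : G <| H by rewrite /normal sGH join_subG normG.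
case: (arg_minnP (P := [in H]) (fun h => #|A :&: A :^ h|) (group1 H)) => h Hh minh.
have /mulsgP[a g Aa Gg def_h] : h \in A * G by rewrite -defH.
(* Conjugation by [a] preserves [A], so the minimising conjugator can be taken in [G]. *)
have defAh : A :^ h = A :^ g by rewrite def_h conjsgM (conjGid Aa).
have sAF : A :&: [group of A :^ h] \subset 'F(H).
  apply: minimal_cap_Fitting; rewrite ?abelianJ ?conj_subG // => k Hk /= sAA.
  have /eqP eqA : A :&: (A :^ h) :^ k == A :&: A :^ h.
    by rewrite eqEcard sAA -conjsgM minh //= groupM.
  by rewrite -eqA subsetIr.
exists g => //.
(* An element of [A] commuting with [g] lies in [A :&: A :^ g]. Moreover [[~: 'F(H), G]] lies in
   ['F(H) :&: G], a nilpotent normal subgroup of [G], so it is trivial. *)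
apply: subset_trans (_ : 'F(H) \subset 'C(G)).
  apply: subset_trans sAF; apply/subsetP=> b /setIP[Ab cb].
  by rewrite inE Ab /= defAh mem_conjg conjgE invgK mulgA -(cent1P cb) mulgK.
rewrite (sameP commG1P trivgP) -FG1.
have nsFH := Fitting_normal H.
have nFG : [~: 'F(H), G] \subset 'F(H) :&: G.
  rewrite subsetI commg_subl (subset_trans sGH (normal_norm nsFH)).
  by rewrite commg_subr (subset_trans (Fitting_sub H) (normal_norm nsGH)).
apply: subset_trans nFG (Fitting_max _ _).
  by rewrite /= setIC (normalGI sGH).
exact: nilpotentS (subsetIl _ _) (Fitting_nil H).
Qed.

(** * The action modulo a minimal normal subgroup *)

Lemma cent_quotientP (gT : finGroupType) (E G : {group gT}) b :
    G \subset 'N(E) -> b \in 'N(E) ->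
  reflect {in G, forall g, [~ g, b] \in E} (coset E b \in 'C(G / E)).
Proof.
move=> nEG nEb; apply: (iffP centP) => [cb g Gg | cb _ /morphimP[g nEg Gg ->]].
  have nEg := subsetP nEG g Gg.
  apply: coset_idr; first by rewrite groupR.
  rewrite morphR //; apply/eqP/commgP/commute_sym/cb.
  exact: mem_quotient.
by apply/commute_sym/commgP; rewrite -morphR //= coset_id ?cb.
Qed.

Lemma index_cent1_leq (gT : finGroupType) (K A : {group gT}) x :
  A \subset 'N(K) -> x \in K -> #|A : 'C_A[x]| <= #|K|.
Proof.
move=> nKA Kx; rewrite index_cent1 subset_leq_card //.
by apply/subsetP=> _ /imsetP[a Aa ->]; rewrite memJ_norm ?(subsetP nKA).
Qed.

Section MinimalNormal.

Variables (gT : finGroupType) (G A E : {group gT}).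
Hypothesis cycA : cyclic A.
Hypotheses (minE : minnormal E (G <*> A)) (abE : is_abelem E) (sEG : E \subset G).

(** The kernel of [A] on [G / E], kept inside [A] so that it still acts on [G] and [E]; the preimage
    form gives its image in [A / E] directly. *)
Definition cent_mod := A :&: coset E @*^-1 'C(G / E).
Canonical cent_mod_group := [group of cent_mod].
Local Notation D := cent_mod.
Local Notation Z := 'C_A(G).

Let nEGA : G <*> A \subset 'N(E). Proof. by case/andP: (mingroupp minE). Qed.
Let nEG : G \subset 'N(E). Proof. exact: subset_trans (joing_subl _ _) nEGA. Qed.
Let nEA : A \subset 'N(E). Proof. exact: subset_trans (joing_subr _ _) nEGA. Qed.
Let ntE : E :!=: 1. Proof. by case/andP: (mingroupp minE). Qed.
Let cAA : abelian A. Proof. exact: cyclic_abelian. Qed.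
Let cEE : abelian E. Proof. by case/is_abelemP: abE => p _ /abelem_abelian. Qed.

Lemma cent_modP b :
  b \in A -> reflect {in G, forall g, [~ g, b] \in E} (b \in D).
Proof.
move=> Ab; have nEb := subsetP nEA b Ab.
have -> : (b \in D) = (coset E b \in 'C(G / E)).
  by rewrite [LHS]in_setI Ab morphpreE in_setI /= nEb [LHS]inE.
exact: cent_quotientP.
Qed.

Lemma cent_modS : Z \subset D.
Proof.
apply/subsetP=> b /setIP[Ab /centP cb]; apply/cent_modP=> // g Gg.
by have /commgP/eqP-> := commute_sym (cb g Gg).
Qed.

Let sDA : D \subset A. Proof. exact: subsetIl. Qed.

Let cDA a b : a \in A -> b \in A -> a ^ b = a.
Proof. by move=> Aa Ab; rewrite /conjg (centsP cAA a Aa b Ab) mulKg. Qed.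

Lemma quotient_cent_mod : D / E = 'C_(A / E)(G / E).
Proof. exact: morphim_setIpre. Qed.

(** Since [G] normalises [E], the kernel [A :&: E] of the projection acts trivially on [G / E], so
    it lies in [D] and no index is lost. *)
Lemma index_cent_mod : #|A / E : 'C_(A / E)(G / E)| = #|A : D|.
Proof.
rewrite -quotient_cent_mod -(index_morphim_ker (coset_morphism E) sDA nEA).
rewrite (_ : #|'ker_A (coset E) : D| = 1%N) ?muln1 //.
apply/eqP; rewrite indexg_eq1 /= ker_coset; apply/subsetP=> b /setIP[Ab Eb].
apply/cent_modP=> // g Gg; rewrite commgEr groupM // memJ_norm ?groupV //.
exact: subsetP nEG g Gg.
Qed.

(** The regular orbit of [coset E x] stays inside the invariant subgroup [K / E]. *)
Lemma index_cent_mod_leq (K : {group gT}) x :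
    A \subset 'N(K) -> x \in K -> x \in 'N(E) ->
    'C_(A / E)[coset E x] \subset 'C(G / E) ->
  #|A : D| <= #|K / E|.
Proof.
move=> nKA Kx nEx sC; rewrite -index_cent_mod.
apply: leq_trans (index_cent1_leq (quotient_norms E nKA) (mem_quotient E Kx)).
apply: dvdn_leq => //; apply: indexgS.
by rewrite subsetI subsetIl.
Qed.

(** A generator [d] of [D] sends [g] to [g * c] with [c] in [E] fixed by [d]; hence [d ^+ n] sends
    [g] to [g * c ^+ n], and [d ^+ p] acts trivially. *)
Lemma index_cent_mod_expn p :
  p.-abelem E -> D \subset 'C(E) -> #|D : Z| %| p.
Proof.
move=> abEp cDE; have [d defD] := cyclicP (cyclicS sDA cycA).
have Dd : d \in D by rewrite defD cycle_id.
have Ad := subsetP sDA d Dd.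
have nZD : D \subset 'N(Z).
  by apply: subset_trans sDA _; apply: sub_abelian_norm => //; apply: subsetIl.
have nZd : d \in 'N(Z) by apply: subsetP nZD d Dd.
rewrite -card_quotient // defD quotient_cycle // -orderE order_dvdn -morphX //=.
apply/eqP/coset_id; rewrite inE groupX //=; apply/centP=> g Gg.
set c := [~ g, d]; have Ec : c \in E by apply: (cent_modP Ad).
have gdn n : g ^ (d ^+ n) = g * c ^+ n.
  elim: n => [|n IHn]; first by rewrite conjg1 mulg1.
  rewrite expgSr conjgM {}IHn conjMg conjXg.
  have -> : c ^ d = c.
    by apply/conjg_fixP/commgP/commute_sym/(centP (subsetP cDE d Dd)).
  by rewrite conjg_mulR -mulgA -expgS.
apply/commute_sym/commgP/conjg_fixP; rewrite gdn.
by case/and3P: abEp => _ _ /exponentP->; rewrite ?mulg1.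
Qed.

Lemma regular_mod x b :
    x \in G -> 'C_(A / E)[coset E x] \subset 'C(G / E) ->
  b \in A -> [~ x, b] \in E -> b \in D.
Proof.
move=> Gx sC Ab Exb; have nEb := subsetP nEA b Ab; have nEx := subsetP nEG x Gx.
apply/cent_modP=> //; apply/cent_quotientP => //; apply: subsetP sC _ _.
rewrite inE mem_quotient //=; apply/cent1P/commute_sym/commgP.
by rewrite -morphR //= coset_id.
Qed.

(** The stabiliser of [x] lies between [Z] and [D], whose index divides the prime [p]; it is not
    [D], so it is [Z]. *)
Lemma regular_lift_unipotent p x :
    p.-abelem E -> D \subset 'C(E) ->
    x \in G -> 'C_(A / E)[coset E x] \subset 'C(G / E) -> x \notin 'C(D) ->
  'C_A[x] \subset 'C(G).
Proof.
move=> abEp cDE Gx sC nCx.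
have [p_pr _ _] := pgroup_pdiv (abelem_pgroup abEp) ntE.
have sCD : 'C_A[x] \subset D.
  apply/subsetP=> b /setIP[Ab /cent1P cb]; apply: (regular_mod Gx) => //.
  by have /commgP/eqP-> := commute_sym cb.
have sZC : Z \subset 'C_A[x] by rewrite setIS // -cent_set1 centS ?sub1set.
have := index_cent_mod_expn abEp cDE; rewrite -(Lagrange_index sCD sZC).
have [_ pP] := primeP p_pr => dvd_p.
have /pP/orP[] := dvdn_trans (dvdn_mulr _ (dvdnn #|D : 'C_A[x]|)) dvd_p.
  rewrite indexg_eq1 => sDC; case/negP: nCx; rewrite -sub_cent1.
  exact: subset_trans sDC (subsetIr _ _).
move/eqP=> eqp; move: dvd_p; rewrite {}eqp -{2}[p]muln1 dvdn_pmul2l ?prime_gt0 //.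
by rewrite dvdn1 indexg_eq1 => sCZ; apply: subset_trans sCZ (subsetIr _ _).
Qed.

(** [E] is minimal and ['C_E[b]] is invariant: under [A] by commutativity, under [G] because
    conjugates of [b] differ from [b] by elements of the abelian group [E]. *)
Lemma cent_mod_fix b : b \in D -> 'C_E[b] = 1 \/ b \in 'C(E).
Proof.
move=> Db; have Ab := subsetP sDA b Db; have [_ minE'] := mingroupP minE.
have [-> | ntC] := eqVneq 'C_E[b] 1; [by left | right].
rewrite -sub_cent1; suff <-: 'C_E[b] = E by apply: subsetIr.
apply: (minE' [group of 'C_E[b]]); last exact: subsetIl.
rewrite /= ntC join_subG /=; apply/andP; split; last first.
  apply: normsI => //; apply: subset_trans (normG _); rewrite sub_cent1.
  exact: subsetP cAA b Ab.
apply/subsetP=> g Gg; rewrite inE; apply/subsetP=> _ /imsetP[e /setIP[Ee /cent1P cbe] ->].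
rewrite inE memJ_norm ?(subsetP nEG) // Ee /= -(conjgKV g b) cent1J memJ_conjg.
apply/cent1P; rewrite conjg_mulR; apply: commuteM => //.
apply: (centsP cEE) => //; rewrite -invg_comm groupV.
by apply: (cent_modP Ab); rewrite ?groupV.
Qed.

(** * Fixed-point-free action on [E] *)

Section FixedPointFree.

Variable d : gT.
Hypotheses (Dd : d \in D) (ncd : d \notin 'C(E)).

Let Ad : d \in A. Proof. exact: subsetP sDA d Dd. Qed.

Lemma cent_mod_fpf e : e \in E -> e ^ d = e -> e = 1.
Proof.
move=> Ee ed; have [C1 | cd] := cent_mod_fix Dd; last by case/negP: ncd.
suff: e \in 'C_E[d] by rewrite C1 => /set1P.
by rewrite inE Ee; apply/cent1P/commgP/conjg_fixP.
Qed.

(** Without fixed points, [e |-> [~ e, d]] is injective on the finite group [E], hence onto, and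
    some [e] cancels [[~ g, d]]. *)
Lemma fpf_complement g : g \in G -> exists2 e, e \in E & g * e \in 'C_G[d].
Proof.
move=> Gg; pose f e := [~ e, d].
have nEd e : e \in E -> e ^ d \in E by rewrite memJ_norm // (subsetP nEA).
have injf : {in E &, injective f}.
  move=> e1 e2 Ee1 Ee2; rewrite /f !commgEl => eqf.
  apply/eqP; rewrite eq_mulgV1; apply/eqP/cent_mod_fpf; first by rewrite groupM ?groupV.
  rewrite conjMg conjVg.
  have -> : e1 ^ d = e1 * (e2^-1 * e2 ^ d) by rewrite -eqf mulKVg.
  by rewrite mulgA mulgK.
have : f @: E = E.
  apply/eqP; rewrite eqEcard card_in_imset // leqnn andbT.
  by apply/subsetP=> _ /imsetP[e Ee ->]; rewrite /f commgEl groupM ?groupV ?nEd.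
have Egd : [~ g, d]^-1 \in E by rewrite groupV; apply: (cent_modP Ad).
move=> /setP/(_ [~ g, d]^-1); rewrite Egd => /imsetP[e Ee def_e].
exists e => //; rewrite inE (groupM Gg (subsetP sEG e Ee)) /=.
apply/cent1P/commgP/conjg_fixP.
rewrite conjMg [g ^ d]conjg_mulR [e ^ d]conjg_mulR -[[~ e, d]]def_e.
by rewrite -(centsP cEE _ Egd e Ee) -mulgA mulKVg.
Qed.

(** The commutator lies in [E] and is fixed by [d], which commutes with both entries. *)
Lemma fpf_comm1 h b : h \in 'C_G[d] -> b \in D -> [~ h, b] = 1.
Proof.
move=> /setIP[Gh /cent1P cdh] Db; have Ab := subsetP sDA b Db.
apply: cent_mod_fpf; first exact: (cent_modP Ab).
rewrite conjRg (cDA Ab) //; congr [~ _, _].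
exact/conjg_fixP/commgP.
Qed.

Lemma fpf_cent_faithful b : b \in D -> b \in 'C(E) -> b \in 'C(G).
Proof.
move=> Db /centP cbE; apply/centP=> g Gg.
have [e Ee Ch] := fpf_complement Gg.
rewrite -(mulgK e g); apply: commuteM; last by apply: commuteV; apply: cbE.
by apply/commute_sym/commgP; rewrite (fpf_comm1 Ch).
Qed.

Lemma fpf_faithful b e : b \in D -> e \in E -> e != 1 -> commute b e -> b \in 'C(G).
Proof.
move=> Db Ee nte cbe; apply: fpf_cent_faithful => //.
have [C1 | //] := cent_mod_fix Db; case/eqP: nte.
suff: e \in 'C_E[b] by rewrite C1 => /set1P.
by rewrite inE Ee; apply/cent1P/commute_sym.
Qed.

(** A nontrivial [e] in [E] has its stabiliser in [D] contained in [Z], and its orbit stays in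
    [E]. *)
Lemma index_cent_mod_fpf : #|D : Z| <= #|E|.
Proof.
have [e Ee nte] := trivgPn _ ntE.
apply: leq_trans (index_cent1_leq (subset_trans sDA nEA) Ee).
apply: dvdn_leq => //; apply: indexgS; rewrite subsetI.
apply/andP; split; first exact: subset_trans (subsetIl _ _) sDA.
apply/subsetP=> b /setIP[Db /cent1P cb]; exact: (fpf_faithful Db Ee nte).
Qed.

Lemma regular_lift_fpf x :
    x \in G -> 'C_(A / E)[coset E x] \subset 'C(G / E) ->
  exists2 y, y \in G & 'C_A[y] \subset 'C(G).
Proof.
move=> Gx sC; have [e1 Ee1 Ch] := fpf_complement Gx.
have [e Ee nte] := trivgPn _ ntE.
have [Gh _] := setIP Ch.
have Gy : x * e1 * e \in G by rewrite -mulgA groupM // (subsetP sEG) // groupM.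
(* If [b] fixes this point, it fixes the coset of [x], so it lies in [D] and fixes [x * e1]; hence
   it also fixes [e]. *)
exists (x * e1 * e) => //; apply/subsetP=> b /setIP[Ab /cent1P cb].
have Db : b \in D.
  apply: (regular_mod Gy) => //; last by have /commgP/eqP-> := commute_sym cb.
  by rewrite -mulgA coset_kerr ?groupM.
have /eqP/commgP chb := fpf_comm1 Ch Db.
apply: (fpf_faithful Db Ee nte).
rewrite -[e](mulKg (x * e1)); apply: commuteM; last exact: commute_sym.
by apply: commuteV; apply: commute_sym.
Qed.

End FixedPointFree.

End MinimalNormal.

(** * Induction on the order of [G] *)

(** The index is the order of the group of automorphisms induced by [A]. Faithfulness is not
    assumed, since [D] becomes trivial on [G / E] in the induction. *)
Theorem cyclic_regular_orbit (gT : finGroupType) (G A : {group gT}) :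
    cyclic A -> A \subset 'N(G) -> #|G| < 2 * #|A : 'C_A(G)| ->
  exists2 x, x \in G & 'C_A[x] \subset 'C(G).
Proof.
have [n] := ubnP #|G|; elim: n gT G A => // n IHn gT G A /ltnSE-leGn cycA nGA large.
have cAA := cyclic_abelian cycA.
have [FG1 | ntF] := eqVneq 'F(G) 1; first exact: Fitting1_regular_orbit.
have nFGA : G <*> A \subset 'N('F(G)).
  by rewrite join_subG gFnorm gFnorm_trans.
have [E minE sEF] := minnormal_exists ntF nFGA.
have [_ ntE abE] := minnormal_solvable minE sEF (nilpotent_sol (Fitting_nil G)).
have sEG := subset_trans sEF (Fitting_sub G).
have nEGA : G <*> A \subset 'N(E) by case/andP: (mingroupp minE).
have [nEG nEA] : G \subset 'N(E) /\ A \subset 'N(E).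
  by move: nEGA; rewrite join_subG => /andP[].
have [p _ abEp] := is_abelemP abE.
pose D := cent_mod_group G A E.
have sDA : D \subset A := subsetIl _ _.
have sZD : 'C_A(G) \subset D := cent_modS minE.
have cardG : #|G| = (#|G / E| * #|E|)%N by rewrite card_quotient // mulnC Lagrange.
have DZ : #|D : 'C_A(G)| <= #|E|.
  have [cDE | /subsetPn[d Dd ncd]] := boolP (D \subset 'C(E)); last first.
    exact: index_cent_mod_fpf Dd ncd.
  apply: dvdn_leq => //; apply: dvdn_trans (index_cent_mod_expn cycA minE abEp cDE) _.
  by have [_ ] := pgroup_pdiv (abelem_pgroup abEp) ntE.
have largeD : #|G / E| < 2 * #|A : D|.
  rewrite ltnNge; apply: contraL large => small; rewrite -leqNgt.
  by rewrite -(Lagrange_index sDA sZD) mulnA cardG leq_mul.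
have [xE] : exists2 x, x \in G / E & 'C_(A / E)[x] \subset 'C(G / E).
  apply: IHn; rewrite ?quotient_cyclic ?quotient_norms //.
    by apply: leq_trans leGn; rewrite ltn_quotient.
  by rewrite (index_cent_mod minE).
case/morphimP=> x nEx Gx -> sC.
have [cDE | /subsetPn[d Dd ncd]] := boolP (D \subset 'C(E)); last first.
  exact: (regular_lift_fpf cycA minE abE sEG Dd ncd Gx sC).
exists x => //; apply: (regular_lift_unipotent cycA minE abEp cDE) => //.
apply: contraL largeD => cDx; rewrite -leqNgt.
pose C := [group of 'C_G(D)].
have nCA : A \subset 'N(C).
  apply: normsI => //; apply: subset_trans (normG _); rewrite centsC.
  exact: subset_trans sDA cAA.
have sEC : E \subset C by rewrite subsetI sEG centsC.
have Cx : x \in C by rewrite inE Gx.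
have leC := index_cent_mod_leq minE nCA Cx nEx sC.
(* If [D] centralises [G], then ['C_A(G) = D] and [#|E| >= 2] contradicts [large]; otherwise [C] has
   index at least 2 in [G], which halves the bound [leC]. *)
have [cGD | ncGD] := boolP (G \subset 'C(D)).
  move: large.
  have -> : 'C_A(G) = D.
    by apply/eqP; rewrite eqEsubset sZD subsetI sDA centsC.
  rewrite ltnNge mulnC cardG leq_mul ?cardG_gt1 //.
  by apply: leq_trans leC _; rewrite subset_leq_card ?quotientS ?subsetIl.
apply: leq_trans (leq_mul (leqnn 2) leC) _.
rewrite !card_quotient ?(subset_trans (subsetIl _ _)) //.
rewrite -(Lagrange_index (subsetIl G 'C(D)) sEC) leq_pmul2r //.
by rewrite indexg_gt1 subsetI subxx.
Qed.

Theorem mainTheorem3 (gT : finGroupType) (G : {group gT}) (alpha : {perm gT})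
    (Aalpha : alpha \in Aut G) (large : (#|G| < 2 * #[alpha])%N) :
  exists2 x : gT, x \in G & #|porbit alpha x| = #[alpha].
Proof.
(* In the semidirect product of [G] by [Aut G], automorphisms act by conjugation and only the
   identity centralises [G], so the index above becomes [#[alpha]]. *)
pose s1 := sdpair1 [Aut G]; pose s2 := sdpair2 [Aut G].
have sAut : <[alpha]> \subset Aut G by rewrite cycle_subG.
have actE x b : b \in <[alpha]> -> [Aut G]%gact x b = b x.
  by move=> /(subsetP sAut) Ab; rewrite /= /autact /= /aperm.
have cent_s2 b : b \in <[alpha]> -> s2 b \in 'C(s1 @* G) -> b = 1.
  move=> alb /centP cb; have Ab := subsetP sAut b alb.
  apply: (eq_Aut Ab (group1 _)) => x Gx; rewrite perm1 -actE //.
  apply: (injmP (injm_sdpair1 [Aut G])); rewrite ?gact_stable //.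
  apply: etrans (sdpair_act [Aut G] Gx Ab) _; apply/conjg_fixP/commgP/commute_sym/cb.
  exact: mem_morphim.
have [] := @cyclic_regular_orbit _ (s1 @* G) (s2 @* <[alpha]>).
- exact/morphim_cyclic/cycle_cyclic.
- exact: subset_trans (morphimS _ sAut) (im_sdpair_norm _).
- have -> : 'C_(s2 @* <[alpha]>)(s1 @* G) = 1.
    apply/trivgP/subsetP=> _ /setIP[/morphimP[b Ab alb ->] cb].
    by rewrite (cent_s2 b) ?morph1 ?set11.
  by rewrite indexg1 !card_injm ?injm_sdpair1 ?injm_sdpair2.
move=> _ /morphimP[x _ Gx ->] sC; exists x => //.
rewrite porbitE card_orbit.
suff -> : 'C_<[alpha]>[x | 'P] = 1 by rewrite indexg1.
apply/trivgP/subsetP=> b /setIP[alb /astab1P fx]; rewrite inE.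
have Ab := subsetP sAut b alb; apply/eqP/cent_s2 => //; apply: (subsetP sC).
rewrite inE mem_morphim //=; apply/cent1P/commute_sym/commgP/conjg_fixP.
apply: etrans (esym (sdpair_act [Aut G] Gx Ab)) _; congr sdpair1.
by rewrite actE // -[RHS]fx.
Qed.
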